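(* For any wheel $W_n$ of order $n \geq 4$, $$\tilde{\gamma}_{c}(M(W_n)) = \lceil n/2 \rceil.$$
   Context: All graphs are non-empty, finite, undirected and simple. The order of a graph is its number of vertices. The wheel $W_n$ of order $n$ has vertex set $\{v_0, v_1, \dots, v_{n-1}\}$ and edge set $\{v_0v_1, v_0v_2, \dots, v_0v_{n-1}\} \cup \{v_1v_2, v_2v_3, \dots, v_{n-2}v_{n-1}, v_{n-1}v_1\}$. A dominating set of a graph $H$ is a set $S \subseteq V(H)$ such that $N_H[v] \cap S \neq \emptyset$ for every $v \in V(H)$, where $N_H[v]$ is the closed neighborhood of $v$. A dominating set $S$ of $H$ is an outer-connected dominating set if the graph $H - S$ (obtained by deleting the vertices in $S$) is connected. The outer-connected domination number $\tilde{\gamma}_c(H)$ is the minimum cardinality of an outer-connected dominating set of $H$. The middle graph $M(G)$ of a graph $G$ is the graph with vertex set $V(G) \cup E(G)$ (disjoint union), in which two vertices $x,y$ are adjacent if and only if either $x,y \in E(G)$ are distinct edges sharing an endpoint in $G$, or one of them is a vertex of $G$ and the other is an edge of $G$ incident with it. *)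

(* Defs.v *)
From mathcomp Require Import all_boot all_order.

Set Implicit Arguments.
Unset Strict Implicit.
Unset Printing Implicit Defensive.

Import Order.TTheory.

Record sgraph := SGraph {
  vertex :> finType;
  adj : rel vertex;
  adj_sym : symmetric adj;
  adj_irrefl : irreflexive adj
}.

Definition edges (G : sgraph) : {set {set G}} :=
  [set [set p.1; p.2] | p : G * G & adj p.1 p.2].

Definition closed_nbhd (G : sgraph) (v : G) : {set G} :=
  [set w | (w == v) || adj v w].

(* Graphs are non-empty, so a graph without vertices is not connected. *)
Definition connected (G : sgraph) : bool :=
  (0 < #|G|) && [forall x : G, forall y : G, connect (@adj G) x y].

Section Delete.
Variables (G : sgraph) (S : {set G}).

Definition delete_adj : rel {x : G | x \notin S} :=
  fun x y => adj (val x) (val y).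

Lemma delete_adj_sym : symmetric delete_adj.
Proof. by move=> x y; rewrite /delete_adj adj_sym. Qed.

Lemma delete_adj_irrefl : irreflexive delete_adj.
Proof. by move=> x; rewrite /delete_adj adj_irrefl. Qed.

Definition delete : sgraph := SGraph delete_adj_sym delete_adj_irrefl.
End Delete.

Definition dominating (G : sgraph) (S : {set G}) : bool :=
  [forall v : G, closed_nbhd v :&: S != set0].

Definition outer_connected_dominating (G : sgraph) (S : {set G}) : bool :=
  dominating S && connected (delete S).

(* The initial value #|G| bounds every #|S|, so this is the true minimum as soon
   as an outer-connected dominating set exists (see the two lemmas below).
   Counting S = V(G) as outer-connected would not change the value. *)
Definition outer_connected_domination_number (G : sgraph) : nat :=
  \big[Order.min/#|G|]_(S : {set G} | outer_connected_dominating S) #|S|.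

Lemma outer_connected_domination_number_le (G : sgraph) (S : {set G}) :
  outer_connected_dominating S -> outer_connected_domination_number G <= #|S|.
Proof.
by move=> oS; rewrite -leEnat; apply: bigmin_le_cond.
Qed.

Lemma outer_connected_domination_number_attained (G : sgraph) (S0 : {set G}) :
  outer_connected_dominating S0 ->
  exists2 S : {set G}, outer_connected_dominating S
                     & #|S| = outer_connected_domination_number G.
Proof.
move=> oS0; set g := outer_connected_domination_number G.
have [gE|//] : g = #|G| \/ exists2 S : {set G},
    outer_connected_dominating S & #|S| = g.
  rewrite /g /outer_connected_domination_number.
  apply: (big_ind (fun m => m = #|G| \/ exists2 S : {set G},
    outer_connected_dominating S & #|S| = m)) => [|m p Hm Hp|S oS].
  - by left.
  - by rewrite minEnat /minn; case: ifP.
  - by right; exists S.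
exists S0 => //; apply/eqP.
by rewrite eqn_leq outer_connected_domination_number_le // andbT -/g gE max_card.
Qed.

Section Middle.
Variable G : sgraph.

Definition middle_adj : rel (G + {e : {set G} | e \in edges G}) :=
  fun x y => match x, y with
  | inl _, inl _ => false
  | inl v, inr e | inr e, inl v => v \in val e
  | inr e, inr f => (e != f) && (val e :&: val f != set0)
  end.

Lemma middle_adj_sym : symmetric middle_adj.
Proof. by case=> [v|e] [w|f] //=; rewrite eq_sym setIC. Qed.

Lemma middle_adj_irrefl : irreflexive middle_adj.
Proof. by case=> [v|e] //=; rewrite eqxx. Qed.

Definition middle : sgraph := SGraph middle_adj_sym middle_adj_irrefl.
End Middle.

Section Wheel.
Variable n : nat.

(* Each edge of the wheel in one orientation: the spokes v_0 v_j, the path edges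
   v_i v_(i+1) with i >= 1, and the closing edge v_(n-1) v_1. *)
Definition wheel_arc : rel 'I_n := fun i j =>
  [|| (i == 0 :> nat) && (0 < j),
      (0 < i) && (j == i.+1 :> nat)
    | (i == n.-1 :> nat) && (j == 1 :> nat)].

(* The condition i != j only matters for n = 2, where v_(n-1) = v_1. *)
Definition wheel_adj : rel 'I_n := fun i j =>
  (i != j) && (wheel_arc i j || wheel_arc j i).

Lemma wheel_adj_sym : symmetric wheel_adj.
Proof. by move=> i j; rewrite /wheel_adj eq_sym orbC. Qed.

Lemma wheel_adj_irrefl : irreflexive wheel_adj.
Proof. by move=> i; rewrite /wheel_adj eqxx. Qed.

Definition wheel : sgraph := SGraph wheel_adj_sym wheel_adj_irrefl.
End Wheel.

(* Main.v *)
Require Import Defs.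
From mathcomp Require Import all_boot all_order.
From mathcomp Require Import zify.

Set Implicit Arguments.
Unset Strict Implicit.
Unset Printing Implicit Defensive.

(** In a middle graph M(G) the vertices coming from G are pairwise non-adjacent,
    and an edge of G sees only its two endpoints among them.  So a member of a
    dominating set takes care of at most two of the vertices of G, and at least
    #|G| / 2 members are needed ([card_le_double_dominating]).

    Conversely, let F be a set of edges of G that covers all the vertices of G.
    Seen inside M(G), the set F is dominating, because any edge of G meets the
    edge of F that covers one of its endpoints.  Deleting F from M(G) leaves a
    graph that contains, as a spanning subgraph, the subdivision of G - F, so it
    stays connected as soon as the spanning subgraph G - F of G is connected
    ([edge_cover_outer_connected_dominating]).

    It remains to find in the wheel an edge cover with uphalf n edges whose
    removal does not disconnect the wheel.  Take the edges v_0v_1, v_2v_3,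
    v_4v_5 and so on; when n is odd the last vertex has no partner, and
    v_(n-2)v_(n-1) is used for it.  All spokes but v_0v_1 survive, and v_1 is
    still attached to the rest by the rim edge v_1v_2. *)

(** * Dominating sets of middle graphs *)

Lemma edgesP (G : sgraph) (e : {set G}) :
  reflect (exists x y : G, adj x y /\ e = [set x; y]) (e \in edges G).
Proof.
apply: (iffP imsetP) => [[[x y] xy ->]|[x [y [xy ->]]]]; last by exists (x, y); rewrite ?inE.
by exists x, y; rewrite inE in xy.
Qed.

Lemma card_closed_nbhd_original (G : sgraph) (x : middle G) :
  #|[set v : G | (inl v : middle G) \in closed_nbhd x]| <= 2.
Proof.
case: x => [w|[e eG]].
  apply: (@leq_trans #|[set w]|); last by rewrite cards1.
  by apply/subset_leq_card/subsetP=> v; rewrite !inE /= orbF.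
have /edgesP [x [y [_ defe]]] := eG.
apply: (@leq_trans #|e|); last by rewrite defe cards2; case: (_ != _).
by apply/subset_leq_card/subsetP=> v; rewrite !inE.
Qed.

(** The neighborhoods of the members of S, cut down to the vertices of G, cover
    G, and each of them has at most two elements. *)
Lemma card_le_double_dominating (G : sgraph) (S : {set middle G}) :
  dominating S -> #|G| <= #|S|.*2.
Proof.
move=> /forallP domS.
pose N (x : middle G) := [set v : G | (inl v : middle G) \in closed_nbhd x].
have -> : #|G| = #|\bigcup_(x in S) N x|.
  rewrite -cardsT; apply: eq_card => v; rewrite inE; apply/esym/bigcupP.
  have /set0Pn [x /setIP [xN xS]] := domS (inl v).
  exists x => //; move: xN; rewrite !inE => /orP [/eqP ->|vx].
    by rewrite eqxx.
  by rewrite adj_sym vx orbT.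
have cardU : forall s : seq (middle G),
    #|\bigcup_(x <- s) N x| <= (size s).*2.
  elim=> [|x s IHs]; first by rewrite big_nil cards0.
  rewrite big_cons; apply: leq_trans (leq_card_setU _ _) _.
  by have := leq_add (card_closed_nbhd_original x) IHs.
by rewrite -big_enum (cardE S) cardU.
Qed.

(** * Edge covers as outer-connected dominating sets *)

Section EdgeCover.
Variables (G : sgraph) (F : {set {set G}}).

Definition middle_edges : {set middle G} :=
  [set x : middle G | if x is inr e then val e \in F else false].

Lemma card_middle_edges : #|middle_edges| <= #|F|.
Proof.
pose f (x : middle G) : {set G} := if x is inr e then val e else set0.
have injf : {in middle_edges &, injective f}.
  by move=> [v|e] [w|e']; rewrite !inE //= => _ _ /val_inj ->.
rewrite -(card_in_imset injf); apply/subset_leq_card/subsetP.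
by move=> _ /imsetP [[v|e]] + ->; rewrite inE.
Qed.

Lemma edge_cover_dominating :
  F \subset edges G -> cover F = setT -> dominating middle_edges.
Proof.
move=> /subsetP FG covF.
have cov v : exists2 e : {e | e \in edges G}, val e \in F & v \in val e.
  have : v \in cover F by rewrite covF.
  by case/bigcupP=> e eF ve; exists (Sub e (FG _ eF)).
apply/forallP=> -[v|f]; apply/set0Pn.
  by have [e eF ve] := cov v; exists (inr e); rewrite !inE eF andbT.
have /edgesP [x [y [_ deff]]] := valP f.
have [e eF xe] := cov x; exists (inr e); rewrite !inE eF andbT /=.
have [->|ef] := eqVneq e f; first by rewrite eqxx.
apply/orP; right; apply/set0Pn.
by exists x; rewrite inE xe deff !inE eqxx.
Qed.

Definition surviving_adj : rel G :=
  fun x y => adj x y && ([set x; y] \notin F).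

Lemma original_survives (v : G) : (inl v : middle G) \notin middle_edges.
Proof. by rewrite inE. Qed.

Let original (v : G) : delete middle_edges := Sub (inl v) (original_survives v).

Let connect_original x y :
  connect surviving_adj x y ->
  connect (@adj (delete middle_edges)) (original x) (original y).
Proof.
case/connectP=> p + ->; elim: p x => [|z p IHp] x //=.
case/andP=> /andP [xz xzF] pth; apply: connect_trans (IHp _ pth).
have xzG : [set x; z] \in edges G by apply/edgesP; exists x, z.
have eS : (inr (Sub [set x; z] xzG) : middle G) \notin middle_edges.
  by rewrite inE.
(* In the middle graph the edge xz subdivides the path from x to z. *)
pose xz_mid : delete middle_edges := Sub (inr (Sub [set x; z] xzG)) eS.
apply: (@connect_trans _ _ xz_mid);
  by apply: connect1; rewrite /= /delete_adj /= !inE eqxx ?orbT.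
Qed.

(** Surviving edges of G are attached to their endpoints, and these are linked
    to the root r through the subdivided paths of G - F. *)
Lemma edge_cover_outer_connected_dominating (r : G) :
  F \subset edges G -> cover F = setT ->
  (forall v, connect surviving_adj r v) ->
  outer_connected_dominating middle_edges.
Proof.
move=> FG covF conF; rewrite /outer_connected_dominating.
rewrite edge_cover_dominating //=; apply/andP; split.
  by apply/card_gt0P; exists (original r).
have symD : connect_sym (@adj (delete middle_edges)).
  by apply: sym_connect_sym; apply: adj_sym.
suff root x : connect (@adj (delete middle_edges)) (original r) x.
  apply/forallP=> x; apply/forallP=> y.
  by apply: connect_trans (root y); rewrite symD.
have orig v := connect_original (conF v).
case: x => -[v|e] xS.
  by rewrite (_ : exist _ _ _ = original v) //; apply: val_inj.
have /edgesP [v [w [_ defe]]] := valP e.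
apply: connect_trans (orig v) (connect1 _).
by rewrite /= /delete_adj /= defe !inE eqxx.
Qed.
End EdgeCover.

(** * An edge cover of the wheel *)

Section WheelCover.
Variable n : nat.
Hypothesis n_ge4 : 4 <= n.

(** The minimum leaves the pairs {2i, 2i+1} alone, except that for odd n it
    moves the last one, {n-1, n}, back to {n-2, n-1}. *)
Definition cover_edge (i : nat) : {set wheel n} :=
  [set x : 'I_n | (x == minn i.*2 (n - 2) :> nat)
               || (x == (minn i.*2 (n - 2)).+1 :> nat)].

Definition wheel_cover : {set {set wheel n}} :=
  [set cover_edge i | i : 'I_(uphalf n)].

Lemma card_wheel_cover : #|wheel_cover| <= uphalf n.
Proof. by apply: leq_trans (leq_imset_card _ _) _; rewrite card_ord. Qed.

Lemma wheel_cover_edges : wheel_cover \subset edges (wheel n).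
Proof.
apply/subsetP=> _ /imsetP [i _ ->]; apply/edgesP.
rewrite /cover_edge; set a := minn _ _.
have an : a.+1 < n by lia.
exists (Ordinal (ltnW an)), (Ordinal an); split.
  by rewrite /= /wheel_adj /wheel_arc -val_eqE /=; lia.
by apply/setP=> x; rewrite !inE -!val_eqE.
Qed.

Lemma cover_wheel_cover : cover wheel_cover = setT.
Proof.
apply/setP=> x; rewrite in_setT; apply/bigcupP.
have xn : x < n := ltn_ord x.
have ix : x./2 < uphalf n by lia.
exists (cover_edge x./2); first by apply/imsetP; exists (Ordinal ix).
by rewrite inE; lia.
Qed.

(** Members of the cover consist of two consecutive numbers, the smaller one
    being even or n - 2; this excludes the spokes v_0v_j with j > 1, and also
    v_1v_2 because n - 2 > 1. *)
Lemma notin_wheel_cover (x y : 'I_n) :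
  x.+1 < y \/ (x = 1 :> nat /\ y = 2 :> nat) ->
  ([set x; y] : {set wheel n}) \notin wheel_cover.
Proof.
move=> xy; apply/imsetP=> -[i _ def].
have : x \in cover_edge i by rewrite -def !inE eqxx.
have : y \in cover_edge i by rewrite -def !inE eqxx orbT.
by rewrite !inE; lia.
Qed.

Lemma connect_wheel_cover (r v : wheel n) :
  r = 0 :> nat -> connect (surviving_adj wheel_cover) r v.
Proof.
move=> r0.
have spoke (w : 'I_n) : 1 < w -> connect (surviving_adj wheel_cover) r w.
  move=> w_gt1; apply: connect1; rewrite /surviving_adj notin_wheel_cover; last first.
    by lia.
  by rewrite andbT /= /wheel_adj /wheel_arc -val_eqE /=; lia.
have [/spoke //|v_le1] := ltnP 1 v.
have [v0|v_gt0] := posnP v.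
  by rewrite (_ : v = r) //; apply: val_inj; rewrite /= v0 r0.
have n_gt2 : 2 < n by lia.
apply: connect_trans (spoke (Ordinal n_gt2) isT) (connect1 _).
rewrite /surviving_adj setUC notin_wheel_cover; last by right => /=; lia.
by rewrite andbT /= /wheel_adj /wheel_arc -val_eqE /=; lia.
Qed.
End WheelCover.

Theorem theorem4p11 (n : nat) (hn : 4 <= n) :
  outer_connected_domination_number (middle (wheel n)) = uphalf n.
Proof.
have n_gt0 : 0 < n by lia.
have ocd : outer_connected_dominating (middle_edges (wheel_cover n)).
  apply: (@edge_cover_outer_connected_dominating (wheel n) _ (Ordinal n_gt0)).
  - exact: wheel_cover_edges.
  - exact: cover_wheel_cover.
  - by move=> v; apply: connect_wheel_cover.
apply/eqP; rewrite eqn_leq; apply/andP; split.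
  apply: leq_trans (outer_connected_domination_number_le ocd) _.
  exact: leq_trans (card_middle_edges _) (card_wheel_cover n).
have [S /andP [domS _] <-] := outer_connected_domination_number_attained ocd.
by have := card_le_double_dominating domS; rewrite card_ord; lia.
Qed.
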